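(* Let $f(x) \in \mathbb{Z}[x]$ be a cubic polynomial (i.e. of degree exactly $3$). Then for each real $\varepsilon > 0$ there exist infinitely many positive integers $n$ such that $f(n) \neq 0$ and $P^+(f(n)) < n^{\frac{3}{4}+\varepsilon}$.
   Context: For a nonzero integer $m$, $P^+(m)$ denotes the largest prime factor of $m$, with the convention $P^+(\pm 1) = 1$. *)

(* Defs.v *)
From mathcomp Require Import all_boot all_order all_algebra.
From mathcomp Require Import all_classical all_reals all_analysis.

Set Implicit Arguments.
Unset Strict Implicit.
Unset Printing Implicit Defensive.

Import Order.TTheory GRing.Theory Num.Theory.
Local Open Scope ring_scope.

(* [max_pdiv 1 = 1], so that [Pplus 1 = Pplus (-1) = 1]; the value
   [Pplus 0 = 1] is junk. *)
Definition Pplus (m : int) : nat := max_pdiv `|m|%N.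

(* Main.v *)
Require Import Defs.
From mathcomp Require Import all_boot all_order all_algebra.
From mathcomp Require Import all_classical all_reals all_analysis.
From mathcomp Require Import ring lra zify.

Set Implicit Arguments.
Unset Strict Implicit.
Unset Printing Implicit Defensive.

Import Order.TTheory GRing.Theory Num.Theory.
Local Open Scope classical_set_scope.
Local Open Scope ring_scope.

(** The values [f(n)] are factored along a sparse sequence of [n] into four
    integers of size [O(n^(3/4))].

    The tool is the doubling formula on the curve [Y^2 = H(X)] for a monic cubic
    [H] with a root [theta]: the abscissa [D] of the double of a point of
    abscissa [s] satisfies [D - theta = eta^2 / H(s)], with [eta] an element of
    [Q(theta)] that depends polynomially on [s].  Hence if
    [H(s) y = H(s) D - l^2], then [H(s) (y - theta) = (eta - l) (eta + l)], and
    taking norms [H(s)^3 H(y) = K(l) K(-l)], where [K] is the characteristic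
    polynomial of [eta] ([depressed_split]).  So [H(y)] splits into two factors
    of equal size, with [y] of the order of [l^2].

    This is used once for [f], which leaves [K(m) K(-m)], and then once for each
    of [K(m)] and [K(-m)], which are values of a single depressed cubic at two
    points with a prescribed sum.  The outcome is four cubic values at
    [l1, -l1, l2, -l2], where [m] has the order of [l1^2] and [l2^2], and [n]
    that of [m^2] ([fourfold_split]).  That the two second splittings concern
    opposite values [m] and [-m] is one equation, that of a conic in [(l1, l2)].
    The tangent to the curve at the point of abscissa [s] gives the solution
    [y = -2s] of the splitting equation ([tangent_split]), hence a point on the
    conic, and a Pell equation ([pell]) moves it to infinitely many integral
    points, with congruences that make [n] an integer ([pell_family]).

    The Pell equation needs its coefficient [Omega t] not to be a square.  This
    coefficient is a sextic in the parameter [t], which can be any integer of an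
    arithmetic progression; its leading coefficient 8 is not a square, so it
    cannot take square values at all large members of the progression
    ([Omega_not_square]). *)

(** * Splitting a cubic by duplication *)

(** The factors 2 here and in the argument [2 * s] below keep integral the
    halves that occur in the duplication formula. *)
Definition depressed (P Q y : int) : int := y ^+ 3 + 2 * P * y + Q.

Definition dbl_c2 (P s : int) : int := 6 * s ^+ 2 + P.

Definition dbl_c1 (P Q s : int) : int :=
  12 * s ^+ 4 + 12 * P * s ^+ 2 + 6 * Q * s - P ^+ 2.

(** Up to a constant this is the 4-division polynomial of [Y^2 = H(X)], divided
    by [Y] and taken at [2 * s]. *)
Definition dbl_c0 (P Q s : int) : int :=
  8 * s ^+ 6 + 20 * P * s ^+ 4 + 20 * Q * s ^+ 3 - 10 * P ^+ 2 * s ^+ 2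
  - 2 * P * Q * s - Q ^+ 2 - P ^+ 3.

(** The characteristic polynomial of
    [eta = P - 2 s^2 + 2 s theta + theta^2], for [theta] a root of
    [depressed P Q]. *)
Definition dbl_poly (P Q s l : int) : int :=
  l ^+ 3 + dbl_c2 P s * l ^+ 2 + dbl_c1 P Q s * l + dbl_c0 P Q s.

Lemma eq_by_sub (A B C D : int) : C = D -> A - B = C - D -> A = B.
Proof. by move=> -> /eqP; rewrite subrr subr_eq0 => /eqP. Qed.

(** Norm of [h (y - theta) = (eta - l) (eta + l)], which holds because
    [eta^2 = (P - 2 s^2)^2 - 4 Q s - h theta] for [h = depressed P Q (2 s)]. *)
Lemma depressed_split (P Q s l y : int) :
  depressed P Q (2 * s) * y = (P - 2 * s ^+ 2) ^+ 2 - 4 * Q * s - l ^+ 2 ->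
  depressed P Q (2 * s) ^+ 3 * depressed P Q y =
  dbl_poly P Q s l * dbl_poly P Q s (- l).
Proof.
set h := depressed P Q (2 * s) => hy.
have -> : h ^+ 3 * depressed P Q y =
    (h * y) ^+ 3 + 2 * P * h ^+ 2 * (h * y) + Q * h ^+ 3.
  by rewrite /depressed; ring.
by rewrite hy /h /depressed /dbl_poly /dbl_c2 /dbl_c1 /dbl_c0; ring.
Qed.

(** The tangent at the point of abscissa [2 s] meets the curve again above
    [D(2 s)], so its slope [dbl_c2 P s / Y] satisfies
    [D(2 s) + 2 * (2 s) = slope^2]: this is the hypothesis of
    [depressed_split] for [y = -4 s]. *)
Lemma tangent_split (P Q s : int) :
  depressed P Q (2 * s) * (- 4 * s) =
  (P - 2 * s ^+ 2) ^+ 2 - 4 * Q * s - dbl_c2 P s ^+ 2.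
Proof. by rewrite /depressed /dbl_c2; ring. Qed.

(** * Splitting a cubic into four factors *)

(** The first duplication is that of [depressed (6 * p) q] with parameter
    [- t].  The roots of [dbl_poly (6 * p) q (- t)] have sum [-6 * nu p t]; the
    coefficients of its translate without quadratic term are [lin2] and
    [cst2]. *)
Definition Phi (p q t : int) : int := depressed (6 * p) q (- 2 * t).

Definition Omega (p q t : int) : int := dbl_c0 (6 * p) q (- t).

Definition nu (p t : int) : int := t ^+ 2 + p.

(** Half of [dbl_c1 (6 * p) q (- t)]. *)
Definition half_c1 (p q t : int) : int :=
  6 * t ^+ 4 + 36 * p * t ^+ 2 - 3 * q * t - 18 * p ^+ 2.

Definition lin2 (p q t : int) : int := half_c1 p q t - 6 * nu p t ^+ 2.

Definition cst2 (p q t : int) : int :=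
  16 * nu p t ^+ 3 - 4 * nu p t * half_c1 p q t + Omega p q t.

Lemma dbl_poly_depressed p q t m :
  dbl_poly (6 * p) q (- t) m =
  depressed (lin2 p q t) (cst2 p q t) (m + 2 * nu p t).
Proof.
rewrite /dbl_poly /depressed /lin2 /cst2 /Omega /nu /half_c1.
by rewrite /dbl_c2 /dbl_c1 /dbl_c0; ring.
Qed.

(** The tangent solution of the first splitting is [m = 6 * nu p t], so that
    [m] and [- m] are translated to [8 * nu p t] and [- 4 * nu p t].  For the
    tangents to give these two points, the parameters of the second
    duplications are [- 2 * nu p t] and [nu p t].  The values of the
    depressed cubic at twice these parameters are minus a square and [Omega]. *)
Lemma depressed_first p q t :
  depressed (lin2 p q t) (cst2 p q t) (2 * (- 2 * nu p t)) = - Phi p q t ^+ 2.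
Proof.
by rewrite /lin2 /cst2 /Omega /Phi /nu /half_c1 /depressed /dbl_c0; ring.
Qed.

Lemma depressed_second p q t :
  depressed (lin2 p q t) (cst2 p q t) (2 * nu p t) = Omega p q t.
Proof. by rewrite /lin2 /cst2 /depressed; ring. Qed.

Definition base1 (p q t : int) : int := dbl_c2 (lin2 p q t) (- 2 * nu p t).

Definition base2 (p q t : int) : int := dbl_c2 (lin2 p q t) (nu p t).

Definition quarter1 (p q t : int) : int -> int :=
  dbl_poly (lin2 p q t) (cst2 p q t) (- 2 * nu p t).

Definition quarter2 (p q t : int) : int -> int :=
  dbl_poly (lin2 p q t) (cst2 p q t) (nu p t).

(** Eliminating [e] from the first two hypotheses leaves the conic.  Here [e]
    is the displacement of [m] from [6 * nu p t], and [E] that of the argument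
    from the tangent value [4 * t]. *)
Lemma fourfold_split p q t l1 l2 e E :
  l1 ^+ 2 = base1 p q t ^+ 2 + Phi p q t ^+ 2 * e ->
  l2 ^+ 2 = base2 p q t ^+ 2 + Omega p q t * e ->
  Phi p q t * E = - (e * (12 * nu p t + e)) ->
  Omega p q t ^+ 3 * (- Phi p q t ^+ 2) ^+ 3 * Phi p q t ^+ 3
    * depressed (6 * p) q (4 * t + E) =
  quarter1 p q t l1 * quarter1 p q t (- l1)
    * (quarter2 p q t l2 * quarter2 p q t (- l2)).
Proof.
move=> hl1 hl2 hE.
set P := lin2 p q t; set Q := cst2 p q t.
have s1 : (- Phi p q t ^+ 2) ^+ 3 * depressed P Q (8 * nu p t + e) =
    quarter1 p q t l1 * quarter1 p q t (- l1).
  rewrite -depressed_first; apply: depressed_split; rewrite hl1.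
  have := tangent_split P Q (- 2 * nu p t).
  rewrite -/(base1 p q t) depressed_first => H.
  by apply: (eq_by_sub H); ring.
have s2 : Omega p q t ^+ 3 * depressed P Q (- 4 * nu p t - e) =
    quarter2 p q t l2 * quarter2 p q t (- l2).
  rewrite -depressed_second; apply: depressed_split; rewrite hl2.
  have := tangent_split P Q (nu p t).
  rewrite -/(base2 p q t) depressed_second => H.
  by apply: (eq_by_sub H); ring.
have s0 : Phi p q t ^+ 3 * depressed (6 * p) q (4 * t + E) =
    depressed P Q (8 * nu p t + e) * depressed P Q (- 4 * nu p t - e).
  have PhiE : depressed (6 * p) q (2 * - t) = Phi p q t.
    by rewrite /Phi; congr depressed; ring.
  have := tangent_split (6 * p) q (- t); rewrite PhiE => H.
  have := @depressed_split (6 * p) q (- t) (6 * nu p t + e) (4 * t + E).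
  rewrite PhiE !dbl_poly_depressed => ->.
    by congr (depressed P Q _ * depressed P Q _); ring.
  rewrite mulrDr hE; apply: (eq_by_sub H).
  by rewrite /dbl_c2 /nu; ring.
by rewrite -s1 -s2 -mulrA s0; ring.
Qed.

(** The unit [x + y Phi sqrt Omega] of norm 1 acts on the conic.  Both squares
    move by multiples of the same [e], and [e] is divisible by [y]. *)
Lemma conic_orbit (Phi Omega u v x y : int) :
  let e := y * (y * (Omega * u ^+ 2 + Phi ^+ 2 * v ^+ 2) + 2 * x * u * v) in
  x ^+ 2 = 1 + Omega * Phi ^+ 2 * y ^+ 2 ->
  (x * u + y * Phi ^+ 2 * v) ^+ 2 = u ^+ 2 + Phi ^+ 2 * e /\
  (x * v + y * Omega * u) ^+ 2 = v ^+ 2 + Omega * e.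
Proof.
move=> e hx; split.
  transitivity (x ^+ 2 * u ^+ 2 + y ^+ 2 * Phi ^+ 4 * v ^+ 2
    + 2 * x * y * Phi ^+ 2 * u * v); first by ring.
  by rewrite hx /e; ring.
transitivity (x ^+ 2 * v ^+ 2 + y ^+ 2 * Omega ^+ 2 * u ^+ 2
  + 2 * x * y * Omega * u * v); first by ring.
by rewrite hx /e; ring.
Qed.

(** * The Pell equation *)

(** Pigeonhole on the fractional parts of [j * s] for [j <= N], sorted into [N]
    intervals of length [1 / N]. *)
Lemma dirichlet (R : realType) (s : R) (N : nat) : (0 < N)%N ->
  exists x y : int, [/\ 0 < y, y <= N%:Z & `|y%:~R * s - x%:~R| < N%:R^-1].
Proof.
move=> N0.
have N0R : 0 < N%:R :> R by rewrite ltr0n.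
pose fr (j : nat) := j%:R * s - (Num.floor (j%:R * s))%:~R.
have fr01 j : 0 <= fr j < 1.
  by rewrite /fr subr_ge0 floor_le /= ltrBlDl -[1]/(1%:~R) -intrD floorD1_gt.
pose ix (j : nat) := Num.truncn (N%:R * fr j).
have ixP j : (ix j)%:R <= N%:R * fr j < (ix j).+1%:R.
  by apply: truncn_itv; rewrite mulr_ge0 // ?ler0n; case/andP: (fr01 j).
have ixN j : (ix j < N)%N.
  have /andP[h _] := ixP j; have /andP[_ h1] := fr01 j.
  rewrite -(ltr_nat R); apply: le_lt_trans h _.
  by rewrite -[ltRHS]mulr1 ltr_pM2l.
pose g (j : 'I_N.+1) : 'I_N := Ordinal (ixN j).
have /injectivePn[i [j nij gij]] : ~~ injectiveb g.
  apply/negP => /injectiveP /leq_card.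
  by rewrite !card_ord ltnn.
wlog lij : i j nij gij / (i < j)%N.
  move=> W; case: (ltngtP i j) => [h|h|h].
  - exact: (W i j).
  - by apply: (W j i) => //; rewrite eq_sym.
  - by move/eqP: nij; case; apply: val_inj.
have {}gij : ix i = ix j by case: gij.
exists (Num.floor (j%:R * s) - Num.floor (i%:R * s)), (j%:Z - i%:Z).
split; [lia| have := ltn_ord j; lia|].
have -> : (j%:Z - i%:Z)%:~R * s -
   (Num.floor (j%:R * s) - Num.floor (i%:R * s))%:~R = fr j - fr i.
  by rewrite /fr !intrD !mulrNz; ring.
rewrite -(ltr_pM2l N0R) divff ?gt_eqF // -[X in X * `| _ |](gtr0_norm N0R) -normrM.
rewrite ltr_norml mulrBr.
have := ixP i; have := ixP j; rewrite gij -(addn1 (ix j)) natrD.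
move: (N%:R * fr j) (N%:R * fr i) ((ix j)%:R) => U V W /andP[h1 h2] /andP[h3 h4].
by apply/andP; split; lra.
Qed.

(** Infinite pigeonhole principle: some colour occurs with arbitrarily small
    values of [mu], since otherwise the finitely many positive lower bounds, one
    for each colour, would have a positive minimum. *)
Lemma small_collision (R : realType) (T : Type) (C : finType) (P : T -> Prop)
    (mu : T -> R) (col : T -> C) :
  (forall u, P u -> 0 < mu u) ->
  (forall d, 0 < d -> exists2 u, P u & mu u < d) ->
  exists u v, [/\ P u, P v, col u = col v & mu v < mu u].
Proof.
move=> mu0 small.
case: (pselect (exists c, forall d, 0 < d -> exists2 u, P u /\ col u = c & mu u < d)).
  case=> c hc; have [u [Pu cu] _] := hc 1 ltr01.
  have [v [Pv cv] vu] := hc _ (mu0 _ Pu).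
  by exists u, v; split=> //; rewrite cu cv.
move=> /forallNP no; exfalso.
have /choice[d dP] : forall c, exists d, 0 < d /\ forall u, P u -> col u = c -> d <= mu u.
  move=> c; have /existsNP[d /not_implyP[d0 hd]] := no c.
  exists d; split=> // u Pu cu; rewrite leNgt; apply/negP => ud.
  by apply: hd; exists u.
have d0 : 0 < \big[Num.min/1]_c d c.
  by apply: (big_ind (fun z => 0 < z)) => // [x y x0 y0|c _]; [rewrite lt_min x0 | case: (dP c)].
have [u Pu] := small _ d0.
apply/negP; rewrite -leNgt (le_trans _ ((dP (col u)).2 u Pu erefl)) //.
exact: bigmin_le_cond.
Qed.

(** By [dirichlet] there are pairs [(x, y)] with [x - y sqrt D] arbitrarily small
    and [x^2 - D y^2] bounded.  Two of them with the same norm [k] and the same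
    residues modulo [k] have a quotient in [Z[sqrt D]], of norm 1; it is
    neither 1 nor -1, because the two pairs are distinct and have [y > 0]. *)
Lemma pell (R : realType) (D : int) : 0 < D -> (forall w, w ^+ 2 != D) ->
  exists x y : int, [/\ 0 < x, 0 < y & x ^+ 2 = 1 + D * y ^+ 2].
Proof.
move=> D0 nsq.
pose s : R := Num.sqrt D%:~R.
have D0R : 0 <= D%:~R :> R by rewrite ler0z ltW.
have s0 : 0 <= s by rewrite sqrtr_ge0.
have s2 : s ^+ 2 = D%:~R by rewrite sqr_sqrtr.
pose nrm (u : int * int) := u.1 ^+ 2 - D * u.2 ^+ 2.
pose mu (u : int * int) : R := `|u.2%:~R * s - u.1%:~R|.
pose K := Num.truncn (2 * s + 2).
pose P (u : int * int) := 0 < u.2 /\ `|nrm u| <= K%:Z.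
have nrm0 u : 0 < u.2 -> nrm u != 0.
  case: u => x y /= y0; apply/negP; rewrite subr_eq0 => /eqP /= e.
  have : ((y %| x)%Z) by rewrite -(@dvdz_pexp2r _ _ 2) // e dvdz_mull.
  case/dvdzP => z xz; move: e; rewrite xz exprMn.
  by move/(mulIf (lt0r_neq0 (exprn_gt0 2 y0)))/eqP; apply/negP.
have nrmE u : (nrm u)%:~R = - (u.2%:~R * s - u.1%:~R) * (u.2%:~R * s + u.1%:~R) :> R.
  by rewrite intrD mulrNz intrM !rmorphXn /= -s2; ring.
have [u [v [[[uy un] [vy vn]] [hk hx hy muv]]]] : exists u v, (P u /\ P v) /\
    [/\ nrm u = nrm v, (u.1 %% nrm u)%Z = (v.1 %% nrm v)%Z,
       (u.2 %% nrm u)%Z = (v.2 %% nrm v)%Z & mu v < mu u].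
  pose c (z : int) : 'I_(K + K).+1 := inord (absz (z + K%:Z)).
  have cI z z' : `|z| <= K%:Z -> `|z'| <= K%:Z -> c z = c z' -> z = z'.
    move=> hz hz' /(congr1 (@nat_of_ord _)); rewrite /c !inordK; lia.
  have md z k : `|k| <= K%:Z -> k != 0 -> `|(z %% k)%Z| <= K%:Z.
    move=> hk k0; rewrite ger0_norm ?modz_ge0 //; apply: le_trans hk.
    exact/ltW/ltz_mod.
  pose col u := (c (nrm u), c (u.1 %% nrm u)%Z, c (u.2 %% nrm u)%Z).
  have [| |u [v [Pu Pv cuv muv]]] := @small_collision R _ _ P mu col.
  - move=> u [u0 _]; rewrite normr_gt0; apply/eqP => h.
    have := nrmE u; rewrite h oppr0 mul0r => /eqP; rewrite intr_eq0.
    exact/negP/nrm0.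
  - move=> d d0; pose N := (Num.truncn d^-1).+1.
    have hN : N%:R^-1 < d.
      by rewrite -[d]invrK ltf_pV2 ?posrE ?invr_gt0 ?ltr0n // truncnS_gt.
    have [x [y [y0 yN hxy]]] := @dirichlet R s N isT.
    exists (x, y); last exact: lt_trans hxy hN.
    split=> //=.
    have : (`|nrm (x, y)|%:~R : R) < 2 * s + 2.
      rewrite intr_norm nrmE /= mulNr normrN normrM.
      have yR : 1 <= y%:~R :> R by rewrite -[1]/(1%:~R) ler_int.
      have yNR : y%:~R <= N%:R :> R by rewrite -[N%:R]/(N%:Z%:~R) ler_int.
      have Nyi : N%:R^-1 <= y%:~R^-1 :> R by rewrite lef_pV2 ?posrE ?ltr0n //; lra.
      have yi1 : y%:~R^-1 <= 1 :> R by rewrite invf_le1 //; lra.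
      have lt1 : `|y%:~R * s - x%:~R| < y%:~R^-1 by apply: lt_le_trans hxy Nyi.
      have le2 : `|y%:~R * s + x%:~R| < 2 * (y%:~R * s) + 1.
        have -> : y%:~R * s + x%:~R = 2 * (y%:~R * s) - (y%:~R * s - x%:~R) by ring.
        apply: le_lt_trans (ler_normB _ _) _.
        rewrite ger0_norm; last by rewrite !mulr_ge0 //; lra.
        by rewrite ltrD2l (lt_le_trans lt1).
      apply: (@lt_le_trans _ _ (y%:~R^-1 * (2 * (y%:~R * s) + 1))).
        by rewrite ltr_pM // ?normr_ge0.
      rewrite mulrDr mulr1 mulrCA mulKf; [lra | by rewrite gt_eqF //; lra].
    move=> h; have : (`|nrm (x, y)|%N <= K)%N.
      by rewrite /K truncn_ge_nat; [rewrite pmulrn abszE ltW | lra].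
    by lia.
  exists u, v; split=> //.
  case: Pu Pv => [uy un] [vy vn].
  case: cuv => /(cI _ _ un vn) h1 h2 h3.
  by split=> //; [apply: cI h2 | apply: cI h3]; rewrite md ?nrm0.
have k0 := nrm0 _ uy.
move: hx hy; rewrite -hk => /esym/eqP; rewrite eqz_mod_dvd => /dvdzP[a ha].
move=> /esym/eqP; rewrite eqz_mod_dvd => /dvdzP[b hb].
case: u v uy un vy vn hk muv ha hb k0 => x y [x' y'] /= y0 un y'0 vn hk muv ha hb k0.
set k := nrm (x, y) in hk ha hb k0.
(* [k X] and [k Y] are the coordinates of the conjugate of [x + y sqrt D] times
   [x' + y' sqrt D]. *)
pose X := 1 + x * a - D * y * b; pose Y := x * b - a * y.
have hx' : x' = x + a * k by rewrite -ha; ring.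
have hy' : y' = y + b * k by rewrite -hb; ring.
have kE : x ^+ 2 = k + D * y ^+ 2 by rewrite /k /nrm /=; ring.
have kE' : x' ^+ 2 = k + D * y' ^+ 2 by rewrite hk /nrm /=; ring.
have XE : x * x' - D * y * y' = k * X.
  transitivity (x ^+ 2 + x * a * k - D * y ^+ 2 - D * y * b * k).
    by rewrite hx' hy'; ring.
  by rewrite kE /X; ring.
have YE : x * y' - x' * y = k * Y.
  by rewrite hx' hy' /Y; ring.
have nXY : X ^+ 2 = 1 + D * Y ^+ 2.
  apply: (mulfI (expf_neq0 2 k0)).
  transitivity ((k * X) ^+ 2); first by ring.
  transitivity (k ^+ 2 + D * (k * Y) ^+ 2); last by ring.
  rewrite -XE -YE.
  transitivity (x ^+ 2 * x' ^+ 2 + D ^+ 2 * y ^+ 2 * y' ^+ 2 - 2 * D * x * x' * y * y').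
    by ring.
  rewrite kE kE'.
  transitivity (k ^+ 2 + D * (x ^+ 2 * y' ^+ 2 + x' ^+ 2 * y ^+ 2 - 2 * x * x' * y * y')).
    by rewrite kE kE'; ring.
  by ring.
have Y0 : Y != 0.
  apply/eqP => h; move: YE; rewrite h mulr0 => /eqP; rewrite subr_eq0 => /eqP e.
  have : k * y' ^+ 2 = k * y ^+ 2.
    transitivity ((x * y') ^+ 2 - D * y ^+ 2 * y' ^+ 2).
      by rewrite exprMn kE; ring.
    by rewrite e exprMn kE'; ring.
  move/(mulfI k0)/eqP; rewrite eqrXn2 // ?ltW // => /eqP yy.
  move: e; rewrite yy => /(mulIf (lt0r_neq0 y0)) xx.
  by move: muv; rewrite xx yy ltxx.
have X0 : X != 0.
  apply/eqP => h; move: nXY; rewrite h expr0n /= => e.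
  have : 0 < 1 + D * Y ^+ 2 by rewrite ltr_pwDl // mulr_ge0 ?sqr_ge0 // ltW.
  by rewrite -e ltxx.
exists `|X|, `|Y|; rewrite !normr_gt0 X0 Y0 -!normrX !ger0_norm ?sqr_ge0 //.
Qed.

Lemma not_square_mul (D m : int) : m != 0 -> (forall w, w ^+ 2 != D) ->
  forall w, w ^+ 2 != D * m ^+ 2.
Proof.
move=> m0 nsq w; apply/negP => /eqP e.
have : (m %| w)%Z by rewrite -(@dvdz_pexp2r _ _ 2) // e dvdz_mull.
case/dvdzP => z wE; move: e; rewrite wE exprMn => /(mulIf (expf_neq0 2 m0))/eqP.
exact/negP.
Qed.

(** * Non-square values of Omega *)

Definition eventually_pos (g : int -> int) := exists T, forall t, T <= t -> 0 < g t.

(** One step of the Horner scheme, so that a polynomial with positive leading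
    coefficient is positive at all large integers. *)
Lemma eventually_pos_horner g c : eventually_pos g -> eventually_pos (fun t => g t * t + c).
Proof.
case=> T hT; exists (`|T| + `|c| + 1) => t ht.
have g1 : 1 <= g t by have := hT t ltac:(lia); lia.
have : t <= g t * t by rewrite ler_peMl //; lia.
by lia.
Qed.

Lemma eventually_pos_cst c : 0 < c -> eventually_pos (fun=> c).
Proof. by exists 0. Qed.

Lemma eventually_pos_ext f g : f =1 g -> eventually_pos f -> eventually_pos g.
Proof. by move=> fg [T hT]; exists T => t /hT; rewrite fg. Qed.

Lemma sqr_neq_double (w d : int) : d != 0 -> w ^+ 2 != 2 * d ^+ 2.
Proof.
move=> d0; apply/eqP => /(congr1 absz).
rewrite abszM !abszX => /(congr1 (logn 2)).
have : (0 < `|d|)%N by lia.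
case: (posnP `|w|%N) => [->|w0] d1; first by rewrite lognM ?expn_gt0 ?d1 // exp0n.
rewrite lognM ?expn_gt0 ?d1 // !lognX (_ : logn 2 2 = 1%N) //; lia.
Qed.

(** The cubic polynomial part of the expansion of [sqrt (Omega p (2 * k) t / 2)]
    for large [t]. *)
Definition half_root (p k t : int) : int := 2 * t ^+ 3 + 15 * p * t - 5 * k.

Lemma Omega_near_double_square p k t :
  Omega p (2 * k) t = 2 * half_root p k t ^+ 2
     - 54 * (15 * p ^+ 2 * t ^+ 2 - 6 * p * k * t + k ^+ 2 + 4 * p ^+ 3).
Proof. by rewrite /Omega /dbl_c0 /half_root; ring. Qed.

(** If [w^2 = Omega p (2 * k) t] and [v = half_root p k t], then [w^2 - 2 v^2] is
    quadratic in [t], while [w + sqrt 2 * v] is at least [t^3] for large [t]. *)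
Lemma sqrt_Omega_approx (R : realType) (p k : int) :
  exists C T : int, [/\ 0 < C, 0 < T &
  forall t w, T <= t -> 0 <= w -> w ^+ 2 = Omega p (2 * k) t ->
   t%:~R * `|w%:~R - Num.sqrt 2 * (half_root p k t)%:~R| <= C%:~R :> R].
Proof.
have [T hT] : eventually_pos (fun t => half_root p k t - t ^+ 3).
  apply: (@eventually_pos_ext (fun t => ((1 * t + 0) * t + 15 * p) * t + - 5 * k)).
    by move=> t; rewrite /half_root; ring.
  by do 3! apply: eventually_pos_horner; apply: eventually_pos_cst.
pose C := 54 * (15 * p ^+ 2 + 6 * `|p * k| + k ^+ 2 + 4 * `|p ^+ 3|) + 1.
have C0 : 0 < C.
  apply: ltr_wpDl => //; apply: mulr_ge0 => //.
  by rewrite !addr_ge0 ?sqr_ge0 // mulr_ge0 ?sqr_ge0.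
exists C, (`|T| + 1); split; [exact: C0 | by lia |].
move=> t w ht w0 hw.
have t0 : 1 <= t by lia.
have hv := hT t ltac:(lia).
have t2 : t <= t ^+ 2 by rewrite expr2 ler_peMl //; lia.
set v := half_root p k t in hv *.
have bd : `|w ^+ 2 - 2 * v ^+ 2| <= C * t ^+ 2.
  rewrite hw Omega_near_double_square -/v [_ - _]addrC addKr normrN normrM.
  have -> : C * t ^+ 2 =
      54 * ((15 * p ^+ 2 + 6 * `|p * k| + k ^+ 2 + 4 * `|p ^+ 3|) * t ^+ 2) + t ^+ 2.
    by rewrite /C; ring.
  have : `|15 * p ^+ 2 * t ^+ 2 - 6 * p * k * t + k ^+ 2 + 4 * p ^+ 3| <=
    (15 * p ^+ 2 + 6 * `|p * k| + k ^+ 2 + 4 * `|p ^+ 3|) * t ^+ 2.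
    have h1 : `|p * k * t| <= `|p * k| * t ^+ 2.
      by rewrite normrM ler_wpM2l ?normr_ge0 // ger0_norm; lia.
    have h2 : k ^+ 2 <= k ^+ 2 * t ^+ 2 by rewrite ler_peMr ?sqr_ge0 //; lia.
    have h3 : `|p ^+ 3| <= `|p ^+ 3| * t ^+ 2 by rewrite ler_peMr ?normr_ge0 //; lia.
    have h4 := sqr_ge0 k.
    have h5 : 0 <= p ^+ 2 * t ^+ 2 by rewrite mulr_ge0 ?sqr_ge0.
    have -> : 15 * p ^+ 2 * t ^+ 2 - 6 * p * k * t = 15 * (p ^+ 2 * t ^+ 2) - 6 * (p * k * t).
      by ring.
    have -> : (15 * p ^+ 2 + 6 * `|p * k| + k ^+ 2 + 4 * `|p ^+ 3|) * t ^+ 2 =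
      15 * (p ^+ 2 * t ^+ 2) + 6 * (`|p * k| * t ^+ 2) + k ^+ 2 * t ^+ 2
      + 4 * (`|p ^+ 3| * t ^+ 2) by ring.
    move: (p ^+ 2 * t ^+ 2) (p * k * t) (`|p * k| * t ^+ 2) (k ^+ 2 * t ^+ 2)
      (`|p ^+ 3| * t ^+ 2) (k ^+ 2) (p ^+ 3) h1 h2 h3 h4 h5 => {ht hw hv t0 t2 C0} ? ? ? ? ? ? ?.
    by lia.
  move=> h; have := sqr_ge0 t; rewrite (_ : `|54| = 54) // => t2'.
  by rewrite -[leLHS]addr0 lerD // ler_wpM2l.
clearbody v.
pose s : R := Num.sqrt 2.
have s0 : 1 <= s by rewrite -[1]sqrtr1 ler_sqrt //; lra.
have s2 : s ^+ 2 = 2 by rewrite sqr_sqrtr //; lra.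
rewrite -/s.
have t0R : 0 < t%:~R :> R by rewrite ltr0z; lia.
have big : t%:~R ^+ 3 <= w%:~R + s * v%:~R :> R.
  have vR : t%:~R ^+ 3 <= v%:~R :> R by rewrite -rmorphXn /= ler_int; lia.
  have wR : 0 <= w%:~R :> R by rewrite ler0z.
  have v0R : 0 <= v%:~R :> R by apply: le_trans vR; rewrite exprn_ge0 // ltW.
  have : v%:~R <= s * v%:~R :> R by rewrite ler_peMl.
  by lra.
rewrite -(ler_pM2r (x := t%:~R ^+ 2)) ?exprn_gt0 //.
apply: (@le_trans _ _ (`|w%:~R - s * v%:~R| * (w%:~R + s * v%:~R))).
  by rewrite mulrC mulrA -exprSr mulrC ler_wpM2l ?normr_ge0.
have big0 : 0 <= w%:~R + s * v%:~R by apply: le_trans big; rewrite exprn_ge0 // ltW.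
rewrite -[X in _ * X](ger0_norm big0) -normrM -subr_sqr exprMn s2.
have -> : w%:~R ^+ 2 - 2 * v%:~R ^+ 2 = (w ^+ 2 - 2 * v ^+ 2)%:~R :> R.
  by rewrite rmorphB rmorphXn rmorphM /= rmorphXn.
by rewrite -intr_norm -rmorphXn /= -intrM ler_int.
Qed.

(** If four consecutive values are squares of integers [w_i], then the [w_i] are
    close to [sqrt 2 * half_root p k (t i)].  The third difference of the cubic
    [half_root] along the progression is the constant [d = 12 a^3], so the third
    difference of the [w_i] is an integer [W] close to [d sqrt 2].  For large [n]
    it is so close that [W^2 - 2 d^2] vanishes, which is absurd since
    [sqrt 2] is irrational. *)
Lemma Omega_not_square (R : realType) (p k a b N : int) : 0 < a ->
  exists2 n, N <= n & forall w, w ^+ 2 != Omega p (2 * k) (a * n + b).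
Proof.
move=> a0; apply: contrapT => no.
have sq n : N <= n -> exists2 w, 0 <= w & w ^+ 2 = Omega p (2 * k) (a * n + b).
  move=> Nn; apply: contrapT => h; apply: no; exists n => // w; apply/eqP => hw.
  by apply: h; exists `|w|; rewrite ?normr_ge0 // -normrX ger0_norm ?sqr_ge0.
have [C [T [C0 T0 near]]] := sqrt_Omega_approx R p k.
pose d : int := 12 * a ^+ 3.
have d0 : 0 < d by rewrite /d mulr_gt0 // exprn_gt0.
pose M := 8 * C * (4 * d + 1) + T.
have M0 : 0 < M by rewrite /M addr_gt0 // !mulr_gt0 //; lia.
pose n := `|N| + M + `|b|.
pose t i := a * (n + i) + b.
have tM i : 0 <= i -> M <= t i.
  move=> i0; have : n + i <= a * (n + i) by rewrite ler_peMl /n; lia.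
  by rewrite /t /n; lia.
pose s : R := Num.sqrt 2.
pose D : R := d%:~R.
have Dpos : 0 < D by rewrite /D ltr0z.
pose q : R := (8 * (4 * D + 1))^-1.
have q0 : 0 < q by rewrite invr_gt0; lra.
have close_root i : 0 <= i -> exists w : int, `|w%:~R - s * (half_root p k (t i))%:~R| <= q.
  move=> i0; have [w w0 hw] := sq (n + i) ltac:(rewrite /n; lia).
  exists w; have Mt := tM i i0.
  have h0 : 0 < 8 * C * (4 * d + 1) by rewrite !mulr_gt0 //; lia.
  have h := near (t i) w ltac:(rewrite /M in Mt; lia) w0 hw.
  have CR : 0 < C%:~R :> R by rewrite ltr0z.
  have Cq : C%:~R * q^-1 <= (t i)%:~R.
    rewrite /q invrK -[8]/(8%:~R) -[4]/(4%:~R) -[1]/(1%:~R) /D -intrM -intrD -!intrM ler_int.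
    by rewrite /M in Mt; lia.
  move: h; set E := `| _ |; move: Cq => Cq h.
  have {}h : C%:~R * q^-1 * E <= C%:~R by apply: le_trans h; rewrite ler_wpM2r ?normr_ge0.
  rewrite -mulrA in h; move: h; rewrite ger_pMr // mulrC => h.
  by rewrite -[q]mul1r -ler_pdivrMr.
have [w0 h0] := close_root 0 isT; have [w1 h1] := close_root 1 isT.
have [w2 h2] := close_root 2 isT; have [w3 h3] := close_root 3 isT.
pose W := w3 - 3 * w2 + 3 * w1 - w0.
have vE : half_root p k (t 3) =
    d + 3 * half_root p k (t 2) - 3 * half_root p k (t 1) + half_root p k (t 0).
  by rewrite /half_root /d /t; ring.
clearbody d.
have WR : W%:~R = w3%:~R - 3 * w2%:~R + 3 * w1%:~R - w0%:~R :> R.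
  by rewrite /W; ring.
have near_W : `|W%:~R - s * D| <= (4 * D + 1)^-1.
  have -> : (4 * D + 1)^-1 = 8 * q by rewrite /q invfM mulVKf // pnatr_eq0.
  have vR : (half_root p k (t 3))%:~R = D + 3 * (half_root p k (t 2))%:~R
      - 3 * (half_root p k (t 1))%:~R + (half_root p k (t 0))%:~R :> R.
    by rewrite vE /D; ring.
  rewrite vR in h3; rewrite WR; move: h0 h1 h2 h3; rewrite !ler_norml.
  move: (half_root p k (t 0))%:~R (half_root p k (t 1))%:~R (half_root p k (t 2))%:~R => v0 v1 v2.
  have -> : s * (D + 3 * v2 - 3 * v1 + v0) = s * D + 3 * (s * v2) - 3 * (s * v1) + s * v0.
    by ring.
  move: (s * v0) (s * v1) (s * v2) (s * D) => x0 x1 x2 x3.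
  move=> /andP[? ?] /andP[? ?] /andP[? ?] /andP[? ?]; apply/andP; split; lra.
have s0 : 0 <= s by rewrite sqrtr_ge0.
have s2 : s ^+ 2 = 2 by rewrite sqr_sqrtr //; lra.
have s32 : s <= 3 / 2 by rewrite -(ler_pXn2r (n := 2)) ?nnegrE // ?s2; lra.
have lt1 : `|(W ^+ 2 - 2 * d ^+ 2)%:~R| < 1 :> R.
  have -> : (W ^+ 2 - 2 * d ^+ 2)%:~R = (W%:~R - s * D) * (W%:~R + s * D) :> R.
    by rewrite -subr_sqr exprMn s2 rmorphB rmorphXn rmorphM /= rmorphXn.
  have sum_le : `|W%:~R + s * D| <= 3 * D + 1.
    have -> : W%:~R + s * D = (W%:~R - s * D) + 2 * (s * D) by ring.
    have inv1 : (4 * D + 1)^-1 <= 1 by rewrite invf_le1; lra.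
    have sD : 0 <= s * D <= 3 / 2 * D by rewrite mulr_ge0 ?ler_wpM2r //; lra.
    apply: le_trans (ler_normD _ _) _.
    rewrite [`|2 * _|]ger0_norm; lra.
  rewrite normrM; apply: (@le_lt_trans _ _ ((4 * D + 1)^-1 * (3 * D + 1))).
    by rewrite ler_pM ?normr_ge0.
  by rewrite mulrC ltr_pdivrMr; lra.
have : `|W ^+ 2 - 2 * d ^+ 2| < 1 by rewrite -(ltr_int R) intr_norm.
have := sqr_neq_double W (lt0r_neq0 d0).
by rewrite -subr_eq0; move: (_ - _) => z; clear; lia.
Qed.

(** * Infinitely many split values *)

(** Fourth powers keep the exponents integral: the value of a cubic at [l] is
    [O(X^(3/2))] when [l^2 <= X]. *)
Lemma dbl_poly_bound (P Q s : int) :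
  exists S, forall l X, l ^+ 2 <= X -> 1 <= X ->
  dbl_poly P Q s l ^+ 4 <= S * X ^+ 6 /\ dbl_poly P Q s (- l) ^+ 4 <= S * X ^+ 6.
Proof.
pose S := 4 * (1 + dbl_c2 P s ^+ 2 + dbl_c1 P Q s ^+ 2 + dbl_c0 P Q s ^+ 2).
exists (S ^+ 2).
suff main l X : l ^+ 2 <= X -> 1 <= X -> dbl_poly P Q s l ^+ 4 <= S ^+ 2 * X ^+ 6.
  by move=> l X lX X1; split; apply: main => //; rewrite sqrrN.
move=> lX X1; rewrite -[4%N]/(2 * 2)%N -[6%N]/(3 * 2)%N !exprM -exprMn.
have X0 : 0 <= X by lia.
have l0 : 0 <= l ^+ 2 by apply: sqr_ge0.
have X13 : 1 <= X ^+ 3 by apply: exprn_ege1.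
have XX3 : X <= X ^+ 3 by apply: ler_eXnr.
have XX23 : X ^+ 2 <= X ^+ 3 by apply: ler_weXn2l.
have l43 : (l ^+ 2) ^+ 2 <= X ^+ 3 by apply: le_trans XX23; rewrite lerXn2r ?nnegrE.
have l63 : (l ^+ 3) ^+ 2 <= X ^+ 3 by rewrite -exprM mulnC exprM lerXn2r ?nnegrE.
rewrite ler_pXn2r ?nnegrE ?sqr_ge0 //; last first.
  by rewrite mulr_ge0 //; [rewrite /S mulr_ge0 // !addr_ge0 ?sqr_ge0 | lia].
rewrite /dbl_poly /S; move: (dbl_c2 P s) (dbl_c1 P Q s) (dbl_c0 P Q s) => u v w.
have cs (x y z t : int) : (x + y + z + t) ^+ 2 <= 4 * (x ^+ 2 + y ^+ 2 + z ^+ 2 + t ^+ 2).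
  rewrite -subr_ge0.
  have -> : 4 * (x ^+ 2 + y ^+ 2 + z ^+ 2 + t ^+ 2) - (x + y + z + t) ^+ 2 =
     (x - y) ^+ 2 + (x - z) ^+ 2 + (x - t) ^+ 2 + (y - z) ^+ 2 + (y - t) ^+ 2 + (z - t) ^+ 2.
    by ring.
  by rewrite !addr_ge0 ?sqr_ge0.
apply: le_trans (cs _ _ _ _) _.
rewrite -mulrA ler_wpM2l // !mulrDl mul1r [(u * _) ^+ 2]exprMn [(v * _) ^+ 2]exprMn.
rewrite !lerD // ?ler_wpM2l ?sqr_ge0 //; first exact: le_trans lX XX3.
by rewrite ler_peMr ?sqr_ge0.
Qed.

(** The tangent point is moved by solutions of
    [x^2 = 1 + Omega * Phi^2 * y^2] with [y] divisible by [Phi * N] and by an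
    arbitrary [B].  Then [e] is divisible by [Phi * N * B], so that the
    displacement [E = N * h] of [fourfold_split] has an integral [h >= B].
    Since [l1^2] and [l2^2] are [O(e)] and [h] is at least of the order of
    [e^2], the four cubic values are [O(e^(3/2)) = O(h^(3/4))]. *)
Lemma pell_family (R : realType) (p q t N : int) :
  0 < N -> Phi p q t < 0 ->
  0 < Omega p q t -> (forall w, w ^+ 2 != Omega p q t) -> 0 < nu p t ->
  0 < base1 p q t -> 0 < base2 p q t ->
  exists2 C : int, 0 <= C & forall B, exists h K A1 A2 A3 A4 : int,
   [/\ B <= h, K != 0,
       K * depressed (6 * p) q (4 * t + N * h) = A1 * A2 * (A3 * A4) &
    [/\ A1 ^+ 4 <= C * h ^+ 3, A2 ^+ 4 <= C * h ^+ 3,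
        A3 ^+ 4 <= C * h ^+ 3 & A4 ^+ 4 <= C * h ^+ 3]].
Proof.
have [S1 hS1] := dbl_poly_bound (lin2 p q t) (cst2 p q t) (- 2 * nu p t).
have [S2 hS2] := dbl_poly_bound (lin2 p q t) (cst2 p q t) (nu p t).
move: hS1 hS2 (@fourfold_split p q t).
rewrite /quarter1 /quarter2.
move: (dbl_poly _ _ (- 2 * nu p t)) (dbl_poly _ _ (nu p t)) => K1 K2.
move: (Phi p q t) (Omega p q t) (nu p t) (base1 p q t) (base2 p q t) => Phi Omega nu u v.
move=> hS1 hS2 fac N0 Phi0 Om0 nsq nu0 u0 v0.
(* [F h = e (12 nu + e)], hence the bound [e^2 <= F h] below. *)
pose F := - Phi * N.
have F0 : 0 < F by rewrite mulr_gt0 // oppr_gt0.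
pose L := u ^+ 2 + v ^+ 2 + Phi ^+ 2 + Omega.
have L0 : 0 < L by rewrite ltr_wpDl // !addr_ge0 ?sqr_ge0.
have [Lu Lv] : u ^+ 2 + Phi ^+ 2 <= L /\ v ^+ 2 + Omega <= L.
  by rewrite /L; split; have := sqr_ge0 u; have := sqr_ge0 v; have := sqr_ge0 Phi; lia.
clearbody L.
pose S := `|S1| + `|S2|.
have [S0 hS10 hS20] : [/\ 0 <= S, S1 <= S & S2 <= S] by split; rewrite /S; lia.
clearbody S.
have Phi0' : Phi != 0 by lia.
exists (S * L ^+ 6 * F ^+ 3).
  by apply: mulr_ge0; [apply: mulr_ge0 => //|]; apply: exprn_ge0; apply: ltW.
move=> B0; pose B := `|B0| + 1; have B1 : 0 < B by lia.
have BB : B0 <= B by lia.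
clearbody B.
pose M := F * B.
have M0 : 0 < M by rewrite mulr_gt0.
have [x [z [x0 z0 hxz]]] : exists x z : int,
    [/\ 0 < x, 0 < z & x ^+ 2 = 1 + Omega * (Phi * M) ^+ 2 * z ^+ 2].
  apply: (pell R); last by apply: not_square_mul; rewrite // mulf_neq0 ?(lt0r_neq0 M0).
  by rewrite mulr_gt0 // exprn_even_gt0 //= mulf_neq0 ?(lt0r_neq0 M0).
pose y := M * z.
have y0 : 0 < y by rewrite mulr_gt0.
have {}hxz : x ^+ 2 = 1 + Omega * Phi ^+ 2 * y ^+ 2 by rewrite hxz /y; ring.
pose e1 := z * (y * (Omega * u ^+ 2 + Phi ^+ 2 * v ^+ 2) + 2 * x * u * v).
have e10 : 0 < e1.
  rewrite mulr_gt0 // ltr_wpDl ?mulr_gt0 // mulr_ge0 ?(ltW y0) //.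
  by rewrite addr_ge0 // mulr_ge0 ?sqr_ge0 ?(ltW Om0).
have [] := conic_orbit u v hxz.
have -> : y * (y * (Omega * u ^+ 2 + Phi ^+ 2 * v ^+ 2) + 2 * x * u * v) = M * e1.
  by rewrite /e1 [RHS]mulrA.
move: (x * u + _) (x * v + _) => l1 l2 hl1 hl2.
clearbody e1 => {hxz}.
pose e := M * e1; rewrite -/e in hl1 hl2.
have e0 : 0 < e by rewrite mulr_gt0.
pose h := B * e1 * (12 * nu + e).
have hF : F * h = e * (12 * nu + e) by rewrite /h /e /M; ring.
have {}fac := fac l1 l2 e (N * h) hl1 hl2.
have {}fac := fac ltac:(by rewrite mulrA -hF /F; ring).
exists h, (Omega ^+ 3 * (- Phi ^+ 2) ^+ 3 * Phi ^+ 3), (K1 l1), (K1 (- l1)), (K2 l2), (K2 (- l2)).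
have e_ge1 : 1 <= e by [].
have Bh : B <= h.
  rewrite /h -mulrA ler_peMr ?(ltW B1) //.
  have : 1 * 1 <= e1 * (12 * nu + e) by rewrite ler_pM //; lia.
  by rewrite mulr1.
have e2 : e ^+ 2 <= F * h.
  by rewrite hF expr2 ler_wpM2l ?(ltW e0) // lerDr mulr_ge0 // ltW.
have bound S' A : S' <= S -> A <= S' * (L * e) ^+ 6 -> A <= S * L ^+ 6 * F ^+ 3 * h ^+ 3.
  move=> hS hA; apply: le_trans hA _.
  have h1 : (e ^+ 2) ^+ 3 <= (F * h) ^+ 3.
    by rewrite lerXn2r ?nnegrE ?sqr_ge0 // (le_trans _ e2) ?sqr_ge0.
  apply: (@le_trans _ _ (S * (L ^+ 6 * (e ^+ 2) ^+ 3))).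
    rewrite -exprM -exprMn ler_wpM2r // exprn_ge0 // mulr_ge0 // ltW //.
  have -> : S * L ^+ 6 * F ^+ 3 * h ^+ 3 = S * (L ^+ 6 * (F * h) ^+ 3) by ring.
  by rewrite ler_wpM2l // ler_wpM2l // exprn_ge0 // ltW.
have le_Le (w r G : int) : w ^+ 2 = r + G * e -> 0 <= r -> r + G <= L -> w ^+ 2 <= L * e.
  move=> -> r0 rG; apply: (@le_trans _ _ ((r + G) * e)); last by rewrite ler_wpM2r // ltW.
  by rewrite mulrDl lerD2r ler_peMr.
have b1 := le_Le _ _ _ hl1 (sqr_ge0 u) Lu.
have b2 := le_Le _ _ _ hl2 (sqr_ge0 v) Lv.
have Le1 : 1 <= L * e by rewrite -gtz0_ge1 mulr_gt0.
have [h1 h2] := hS1 _ _ b1 Le1; have [h3 h4] := hS2 _ _ b2 Le1.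
split=> //; first exact: le_trans BB Bh.
  by rewrite !mulf_neq0 ?expf_neq0 ?oppr_eq0 ?expf_neq0 ?(lt0r_neq0 Om0).
by split; [apply: bound h1|apply: bound h2|apply: bound h3|apply: bound h4].
Qed.

(** The cubic is depressed by the substitution [y = 4 (3 a n + b)], which makes
    integral every quantity of the construction.  A step [h] of [n] moves [y] by
    [12 a h], whence the modulus [N = 12 a] in [pell_family].  The parameter
    [t = 3 a n0 + b] is chosen so that the tangent value [4 t] comes from the
    integer [n0]. *)
Lemma cubic_fourfold_values (R : realType) (a b c d : int) :
  0 < a -> exists2 C : int, 0 <= C &
  forall B, exists n K A1 A2 A3 A4 : int,
   [/\ B <= n, K != 0,
       K * (a * n ^+ 3 + b * n ^+ 2 + c * n + d) = A1 * A2 * (A3 * A4) &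
    [/\ A1 ^+ 4 <= C * n ^+ 3, A2 ^+ 4 <= C * n ^+ 3,
        A3 ^+ 4 <= C * n ^+ 3 & A4 ^+ 4 <= C * n ^+ 3]].
Proof.
move=> a0.
pose p := 4 * (3 * a * c - b ^+ 2).
pose k := 32 * (2 * b ^+ 3 - 9 * a * b * c + 27 * a ^+ 2 * d).
have [r r0 depressedE] : exists2 r, r != 0 & forall n,
    depressed (6 * p) (2 * k) (4 * (3 * a * n + b)) = r * (a * n ^+ 3 + b * n ^+ 2 + c * n + d).
  exists (1728 * a ^+ 2); last by move=> n; rewrite /depressed /k /p; ring.
  by apply: mulf_neq0; [rewrite pnatr_eq0 | rewrite expf_neq0 // lt0r_neq0].
clearbody p k; pose q := 2 * k.
have [T1 hT1] : eventually_pos (fun t => - Phi p q t).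
  apply: (@eventually_pos_ext (fun t => ((8 * t + 0) * t + 24 * p) * t + - q)).
    by move=> t; rewrite /Phi /depressed; ring.
  by do 3! apply: eventually_pos_horner; apply: eventually_pos_cst.
have [T2 hT2] : eventually_pos (Omega p q).
  apply: (@eventually_pos_ext (fun t => (((((8 * t + 0) * t + 120 * p) * t + - 20 * q) * t
     + - (360 * p ^+ 2)) * t + 12 * p * q) * t + (- q ^+ 2 - 216 * p ^+ 3))).
    by move=> t; rewrite /Omega /dbl_c0; ring.
  by do 6! apply: eventually_pos_horner; apply: eventually_pos_cst.
have [T3 hT3] : eventually_pos (base2 p q).
  apply: (@eventually_pos_ext (fun t => (((6 * t + 0) * t + 36 * p) * t + - 3 * q) * t + - 18 * p ^+ 2)).
    by move=> t; rewrite /base2 /dbl_c2 /lin2 /half_c1; ring.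
  by do 4! apply: eventually_pos_horner; apply: eventually_pos_cst.
have [T4 hT4] : eventually_pos (nu p).
  apply: (@eventually_pos_ext (fun t => (1 * t + 0) * t + p)).
    by move=> t; rewrite /nu; ring.
  by do 2! apply: eventually_pos_horner; apply: eventually_pos_cst.
have a30 : 0 < 3 * a by lia.
have [n0 hn0 nsq] := Omega_not_square R p k b (`|b| + `|T1| + `|T2| + `|T3| + `|T4|) a30.
have n00 : 0 <= n0 by lia.
rewrite -/q in nsq; set t := 3 * a * n0 + b in nsq.
have tT : n0 - `|b| <= t.
  have : n0 <= (3 * a) * n0 by rewrite ler_peMl //; lia.
  by rewrite /t; lia.
have [t1 t2 t3 t4] : [/\ T1 <= t, T2 <= t, T3 <= t & T4 <= t] by split; lia.
have Phi0 : Phi p q t < 0 by rewrite -oppr_gt0 hT1.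
have base1_gt0 : 0 < base1 p q t.
  have -> : base1 p q t = base2 p q t + 18 * nu p t ^+ 2 by rewrite /base1 /base2 /dbl_c2; ring.
  by apply: ltr_wpDr; [apply: mulr_ge0 => //; apply: sqr_ge0 | apply: hT3].
have a12 : 0 < 12 * a by rewrite mulr_gt0.
have [C C0 fam] :=
  pell_family R a12 Phi0 (hT2 t t2) nsq (hT4 t t4) base1_gt0 (hT3 t t3).
exists C => // B; have [h [K [A1 [A2 [A3 [A4 [Bh K0 fac [h1 h2 h3 h4]]]]]]]] := fam (`|B|).
have h0 : 0 <= h := le_trans (normr_ge0 B) Bh.
have hn_le : h <= n0 + h by rewrite lerDr.
exists (n0 + h), (K * r), A1, A2, A3, A4.
have hn : C * h ^+ 3 <= C * (n0 + h) ^+ 3.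
  by rewrite ler_wpM2l // lerXn2r // nnegrE (le_trans h0).
split.
- exact: le_trans (ler_norm B) (le_trans Bh hn_le).
- exact: mulf_neq0.
- rewrite -fac -mulrA -depressedE; congr (_ * depressed _ _ _).
  by rewrite /t; ring.
- by split; apply: le_trans hn.
Qed.

(** * Largest prime factors *)

(** A prime factor of [m] divides one of the four nonzero factors.  The bound
    [1 <= X] covers [m = 1] and [m = -1]. *)
Lemma Pplus_cofactor (m K A1 A2 A3 A4 X : int) :
  K != 0 -> m != 0 -> K * m = A1 * A2 * (A3 * A4) -> 1 <= X ->
  [/\ A1 ^+ 4 <= X, A2 ^+ 4 <= X, A3 ^+ 4 <= X & A4 ^+ 4 <= X] ->
  (Pplus m)%:Z ^+ 4 <= X.
Proof.
move=> K0 m0 e X1 [h1 h2 h3 h4]; rewrite /Pplus.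
have dvd_le (r : nat) (A : int) : A != 0 -> (r %| `|A|)%N -> A ^+ 4 <= X -> r%:Z ^+ 4 <= X.
  move=> A0 rA; apply: le_trans.
  have -> : A ^+ 4 = `|A|%:Z ^+ 4 by rewrite abszE -normrX ger0_norm // exprn_even_ge0.
  by rewrite lerXn2r ?nnegrE // lez_nat dvdn_leq // absz_gt0.
case: (ltnP 1 `|m|%N) => [m1|m1]; last first.
  have -> : max_pdiv `|m|%N = 1%N by have : `|m|%N = 1%N by [lia]; move=> ->.
  by rewrite expr1n.
have pr := max_pdiv_prime m1; have := max_pdiv_dvd `|m|%N.
set r := max_pdiv _ in pr * => rm.
have : (r %| absz (A1 * A2 * (A3 * A4))%R)%N by rewrite -e abszM dvdn_mull.
have := mulf_neq0 K0 m0; rewrite e !mulf_eq0 !negb_or => /andP[/andP[n1 n2] /andP[n3 n4]].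
rewrite !abszM !Euclid_dvdM // => /orP[/orP[]|/orP[]] d.
- exact: dvd_le h1.
- exact: dvd_le h2.
- exact: dvd_le h3.
- exact: dvd_le h4.
Qed.

Lemma PplusN m : Pplus (- m) = Pplus m.
Proof. by rewrite /Pplus abszN. Qed.

Lemma cubic_coef (f : {poly int}) : size f = 4%N -> forall x : int,
  f.[x] = f`_3 * x ^+ 3 + f`_2 * x ^+ 2 + f`_1 * x + f`_0.
Proof.
move=> hf x; rewrite horner_coef hf !big_ord_recl big_ord0 /= addr0.
by rewrite /bump /= !(addn0, add1n) expr0; ring.
Qed.

(** The constant [C + 1] rather than [C] covers the values 1 and -1 of [f]. *)
Lemma smooth_values (R : realType) (f : {poly int}) : size f = 4%N ->
  exists2 C : int, 0 <= C & forall N : nat, exists n : nat,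
   [/\ (N < n)%N, f.[n%:Z] != 0 & (Pplus f.[n%:Z])%:Z ^+ 4 <= C * n%:Z ^+ 3].
Proof.
wlog fpos : f / 0 < f`_3 => [wl hf|hf].
  have : f`_3 != 0.
    by have := lead_coef_eq0 f; rewrite lead_coefE hf => ->; rewrite -size_poly_eq0 hf.
  rewrite neq_lt => /orP[f3|f3]; last exact: wl.
  have [||C C0 hC] := wl (- f); rewrite ?coefN ?oppr_gt0 ?size_polyN //.
  exists C => // N; have [n [Nn]] := hC N.
  by rewrite hornerN oppr_eq0 PplusN => *; exists n.
have [C C0 hC] := cubic_fourfold_values R f`_2 f`_1 f`_0 fpos.
have [T hT] : eventually_pos (fun t => f.[t]).
  apply: (@eventually_pos_ext (fun t => ((f`_3 * t + f`_2) * t + f`_1) * t + f`_0)).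
    by move=> t; rewrite cubic_coef //; ring.
  by do 3! apply: eventually_pos_horner; apply: eventually_pos_cst.
exists (C + 1); first by lia.
move=> N; have [n [K [A1 [A2 [A3 [A4 [Nn K0 fac [h1 h2 h3 h4]]]]]]]] := hC (`|T| + N%:Z + 1).
rewrite -cubic_coef // in fac.
have Tn : T <= n by clear -Nn; lia.
have n_pos : 1 <= n by clear -Nn; lia.
have fn0 : f.[n] != 0 by apply: lt0r_neq0; apply: hT.
have n3 : 1 <= n ^+ 3 by apply: exprn_ege1.
have CX : C * n ^+ 3 <= (C + 1) * n ^+ 3 by rewrite ler_wpM2r ?lerDl // (le_trans _ n3).
have X1 : 1 <= (C + 1) * n ^+ 3 by rewrite mulr_ege1 ?lerDr.
have nE : n = `|n|%N%:Z by clear -n_pos; lia.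
exists `|n|%N; rewrite -nE; split=> //.
  by clear -Nn; lia.
apply: (Pplus_cofactor K0 fn0 fac X1).
by split; apply: le_trans CX.
Qed.

(** Once [n^(4 eps)] exceeds the constant [C] of [smooth_values], the bound
    [C n^3] on the fourth power is less than [n^(3 + 4 eps)]. *)
Theorem mainTheorem2 (R : realType) (f : {poly int}) (hf : size f = 4%N)
    (eps : R) (heps : 0 < eps) :
  infinite_set [set n : nat | [/\ (0 < n)%N,
    f.[n%:Z] != 0 &
    (Pplus f.[n%:Z])%:R < (n%:R : R) `^ (3 / 4 + eps)]].
Proof.
have [C C0 hC] := smooth_values R hf.
have CR : 0 <= C%:~R :> R by rewrite ler0z.
have e0 : 0 < 4 * eps by rewrite mulr_gt0.
move=> /finite_seqP[s sE].
pose b : R := C%:~R `^ (4 * eps)^-1.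
have [n [nN fn0 hP]] := hC (maxn (\max_(i <- s) i) (Num.truncn b).+1).
have n_gt0 : (0 < n)%N by apply: leq_ltn_trans nN.
have nR : 0 < n%:R :> R by rewrite ltr0n.
have : [set` s] n.
  rewrite -sE /=; split=> //.
  rewrite -(ltr_pXn2r (n := 4)) ?nnegrE ?powR_ge0 //.
  rewrite -[ltRHS]powR_mulrn ?powR_ge0 // -powRrM mulrDl (_ : 3 / 4 * 4%:R = 3%:R :> R); last by field.
  rewrite powRD; last by rewrite (gt_eqF nR) implybT.
  rewrite powR_mulrn // (mulrC eps) [ltRHS]mulrC.
  apply: (@le_lt_trans _ _ (C%:~R * n%:R ^+ 3)).
    have : ((Pplus f.[n%:Z])%:Z ^+ 4)%:~R <= (C * n%:Z ^+ 3)%:~R :> R by rewrite ler_int.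
    by rewrite rmorphXn rmorphM /= rmorphXn.
  rewrite ltr_pM2r ?exprn_gt0 //.
  have -> : C%:~R = b `^ (4 * eps) by rewrite /b -powRrM mulVf ?gt_eqF // powRr1.
  rewrite gt0_ltr_powR // ?in_itv /= ?nnegrE ?powR_ge0 //.
  apply: lt_le_trans (truncnS_gt b) _; rewrite ler_nat ltnW //.
  exact: leq_ltn_trans (leq_maxr _ _) nN.
move=> /= ns; have := leq_ltn_trans (leq_maxl _ _) nN.
by rewrite ltnNge (leq_bigmax_seq n ns).
Qed.
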